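(* Let $2\leq p\leq q$ be integers and let $BS(p,q)=\langle a,t\mid ta^pt^{-1}=a^q\rangle$ with generating set $\{a,t\}$. Write $p=2k$ or $p=2k+1$ and $q=2\ell$ or $q=2\ell+1$ with integers $k,\ell$, and set $C_k=1$ if $p=2k$, $C_k=2$ if $p=2k+1$; $C_\ell=1$ if $q=2\ell$, $C_\ell=2$ if $q=2\ell+1$. If $4\leq p\leq q$, the growth rate of $BS(p,q)$ is bounded below by the largest real zero of $$P_{pq}(x)=x^{\ell+1}-x^{\ell}-2(x^{\ell-1}+x^{\ell-2}+\cdots+x^{\ell-k+1})-C_kx^{\ell-k}-2(x^{\ell-1}+x^{\ell-2}+\cdots+x)-C_\ell .$$ In the remaining cases the growth rate of $BS(p,q)$ is bounded below by the largest real zero of the polynomial $P_{pq}$ given by: $P_{22}(x)=x^2-x-2$; $P_{23}(x)=x^2-x-3$; $P_{2q}(x)=x^{\ell+1}-x^{\ell}-x^{\ell-1}-2(x^{\ell-1}+x^{\ell-2}+\cdots+x)-C_\ell$ for $q\geq 4$; $P_{33}(x)=x^2-x-4$; $P_{3q}(x)=x^{\ell+1}-x^{\ell}-2x^{\ell-1}-2(x^{\ell-1}+x^{\ell-2}+\cdots+x)-C_\ell$ for $q\geq 4$.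
   Context: For a group $G$ generated by a finite set $S$, let $\gamma(n)=\#\{x\in G:\|x\|_S\leq n\}$, where $\|\cdot\|_S$ is the word length with respect to $S\cup S^{-1}$. The growth rate of $G$ with respect to $S$ is $\lim_{n\to\infty}\gamma(n)^{1/n}$. *)

(* Defs.v *)
From HB Require Import structures.
From mathcomp Require Import all_boot all_order all_algebra.
From mathcomp Require Import all_classical all_reals all_analysis.
Set Implicit Arguments. Unset Strict Implicit. Unset Printing Implicit Defensive.
Import Order.TTheory GRing.Theory Num.Theory.
Local Open Scope ring_scope.

(* Letters of the alphabet {a, a^-1, t, t^-1}: (is_t, is_inverse). *)
Definition letter := (bool * bool)%type.
Definition la : letter := (false, false).
Definition laI : letter := (false, true).
Definition lT : letter := (true, false).
Definition lTI : letter := (true, true).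
Definition linv (x : letter) : letter := (x.1, ~~ x.2).

Definition word := seq letter.

Definition bs_relator (p q : nat) : word :=
  [:: lT] ++ nseq p la ++ [:: lTI] ++ nseq q laI.

(* Equality in BS(p,q) = < a, t | t a^p t^-1 = a^q >: the congruence on words
   generated by free cancellation and insertion/deletion of the relator. *)
Inductive bs_eq (p q : nat) : word -> word -> Prop :=
| bs_refl w : bs_eq p q w w
| bs_sym u v : bs_eq p q u v -> bs_eq p q v u
| bs_trans u v w : bs_eq p q u v -> bs_eq p q v w -> bs_eq p q u w
| bs_cancel u v x : bs_eq p q (u ++ x :: linv x :: v) (u ++ v)
| bs_rel u v : bs_eq p q (u ++ bs_relator p q ++ v) (u ++ v).

Fixpoint words_len (k : nat) : seq word :=
  if k is k'.+1 then [seq x :: w | x <- [:: la; laI; lT; lTI], w <- words_len k']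
  else [:: [::]].

Definition ball_words (n : nat) : seq word :=
  flatten [seq words_len k | k <- iota 0 n.+1].

(* gamma(n) = #{ g in BS(p,q) : |g|_S <= n }: number of classes among words of
   length <= n, counting each word not equivalent to an earlier one. *)
Definition bs_gamma (p q n : nat) : nat :=
  let L := ball_words n in
  (\sum_(i < size L)
     ~~ `[< exists j : nat, (j < i)%N /\ bs_eq p q (nth [::] L j) (nth [::] L i) >])%N.

Definition bs_growth_seq (R : realType) (p q : nat) (n : nat) : R :=
  ((bs_gamma p q n)%:R) `^ (n%:R^-1).

Definition Cpar (m : nat) : nat := if odd m then 2 else 1.

Definition P_pq (R : realType) (p q : nat) (x : R) : R :=
  let k := p./2 in let l := q./2 in
  let S := \sum_(1 <= i < l) x ^+ i in
  if (4 <= p)%N then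
    x ^+ l.+1 - x ^+ l - 2 * (\sum_(1 <= i < k) x ^+ (l - i))
      - (Cpar p)%:R * x ^+ (l - k) - 2 * S - (Cpar q)%:R
  else if p == 2 then
    (if q == 2 then x ^+ 2 - x - 2
     else if q == 3 then x ^+ 2 - x - 3
     else x ^+ l.+1 - x ^+ l - x ^+ l.-1 - 2 * S - (Cpar q)%:R)
  else
    (if q == 3 then x ^+ 2 - x - 4
     else x ^+ l.+1 - x ^+ l - 2 * x ^+ l.-1 - 2 * S - (Cpar q)%:R).

(* Main.v *)
Require Import Defs.
From HB Require Import structures.
From mathcomp Require Import all_boot all_order all_algebra.
From mathcomp Require Import all_classical all_reals all_analysis.
From mathcomp Require Import zify ring lra.
Import Order.TTheory GRing.Theory Num.Theory.
Import numFieldNormedType.Exports.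
Local Open Scope classical_set_scope.
Local Open Scope ring_scope.

(* BS(p,q) is an HNN extension of <a>, with normal forms a^r1 t^e1 a^r2 t^e2 ..., where r_i is the balanced residue modulo q or p according to whether e_i is 1 or -1, and r_i = 0 forces e_i = e_(i-1). They are pairwise distinct in the group because the group acts on them as on the vertices of its Bass-Serre tree. Whatever the previous sign is, the next syllable is a repetition of it (length 1) or a^r t with 0 <> r mod q or a^r t^-1 with 0 <> r mod p (length 1 + |r|), so normal forms biject with strings over a fixed weighted alphabet. The equation P_pq x = 0 is Kraft's equality: the sum of x^(-length) over this alphabet is 1. Hence a root x > 1 gives at least x^(n - l - 1) normal forms of length at most n. The limit exists by Fekete's lemma since gamma is submultiplicative. *)

(** * Compatibility of the congruence with concatenation *)

Lemma bs_eq_cat p q u v u' v' :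
  bs_eq p q u v -> bs_eq p q u' v' -> bs_eq p q (u ++ u') (v ++ v').
Proof.
have ctx w w' x y : bs_eq p q x y -> bs_eq p q (w ++ x ++ w') (w ++ y ++ w').
  elim=> {x y} [x|x y _ IH|x y z _ IH1 _ IH2|x y c|x y].
  - exact: bs_refl.
  - exact: bs_sym.
  - exact: bs_trans IH1 IH2.
  - have := bs_cancel p q (w ++ x) (y ++ w') c.
    by rewrite -!catA /= -?catA.
  - have := bs_rel p q (w ++ x) (y ++ w').
    by rewrite -!catA.
move=> uv uv'; apply: (@bs_trans _ _ _ (v ++ u')).
  exact: (ctx [::] u').
by have := ctx v [::] _ _ uv'; rewrite !cats0.
Qed.

(** * Division with balanced remainder *)

(* Balanced residues: [- off m, m - off m) consists of the residues of least absolute value, with m/2 rather than -m/2 when m is even. *)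
Definition off (m : nat) : int := m.-1./2%:Z.
Definition rep (m : nat) (r : int) : int := ((r + off m) %% m%:Z)%Z - off m.
Definition carry (m : nat) (r : int) : int := ((r + off m) %/ m%:Z)%Z.
Definition isdigit (m : nat) (r : int) := (- off m <= r) && (r < m%:Z - off m).

Section Digits.

Variable m : nat.
Hypothesis m_gt0 : (0 < m)%N.

Lemma rep_digit r : isdigit m (rep m r).
Proof.
rewrite /isdigit /rep.
have := modz_ge0 (r + off m) (_ : m%:Z != 0).
have := ltz_pmod (r + off m) (_ : 0 < m%:Z).
lia.
Qed.

Lemma rep_carryE r c : isdigit m r ->
  rep m (r + c * m%:Z) = r /\ carry m (r + c * m%:Z) = c.
Proof.
move=> /andP[h1 h2]; rewrite /rep /carry.
have e : r + c * m%:Z + off m = c * m%:Z + (r + off m) by ring.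
rewrite e modzMDl divzMDl; last by lia.
rewrite modz_small; last by lia.
rewrite divz_small; last by lia.
by rewrite addr0; split=> //; ring.
Qed.

Lemma rep_carryK r : rep m r + carry m r * m%:Z = r.
Proof. by rewrite /rep /carry; have := divz_eq (r + off m) m%:Z; lia. Qed.

(** By uniqueness of the division: both sides split [r + n] into a digit plus a multiple of [m].
    This makes [add] additive. *)
Lemma rep_carryD r n :
  rep m (rep m r + n) = rep m (r + n) /\
  carry m r + carry m (rep m r + n) = carry m (r + n).
Proof.
have -> : r + n = rep m (rep m r + n)
    + (carry m r + carry m (rep m r + n)) * m%:Z.
  by rewrite mulrDl; have := rep_carryK r; have := rep_carryK (rep m r + n); lia.
by have [-> ->] := rep_carryE _ (carry m r + carry m (rep m r + n)) (rep_digit (rep m r + n)).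
Qed.

End Digits.

(** * The action on the Bass-Serre tree *)

Section Action.

Variables p q : nat.
Hypothesis p_gt0 : (0 < p)%N.
Hypothesis q_gt0 : (0 < q)%N.

(* [(r1, e1) :: (r2, e2) :: s] stands for the coset a^r1 t^e1 a^r2 t^e2 ... <a>, where [true] is t and [false] is t^-1. These cosets are the vertices of the Bass-Serre tree; discarding the final power of a keeps the action simple and still separates the elements that are counted. *)
Definition stack := seq (int * bool).

Definition md (e : bool) : nat := if e then q else p.

Lemma md_gt0 e : (0 < md e)%N. Proof. by case: e. Qed.

(* [e] is the sign preceding [s]. *)
Fixpoint reduced (e : bool) (s : stack) : bool :=
  if s is (r, e') :: s' then
    [&& isdigit (md e') r, (r == 0) ==> (e' == e) & reduced e' s']
  else true.

(* Left multiplication by a^n: a multiple of q is carried through t by a^q t = t a^p, a multiple of p through t^-1 by a^p t^-1 = t^-1 a^q. *)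
Fixpoint add (n : int) (s : stack) : stack :=
  if s is (r, e) :: s' then
    (rep (md e) (r + n), e) :: add (carry (md e) (r + n) * (md (~~ e))%:Z) s'
  else [::].

Definition push (e : bool) (s : stack) : stack :=
  if s is (r, e') :: s' then
    if (r == 0) && (e' == ~~ e) then s' else (0, e) :: s
  else [:: (0, e)].

Lemma add_add n n' s : add n (add n' s) = add (n' + n) s.
Proof.
elim: s n n' => //= -[r e] s IH n n'.
have [h1 h2] := rep_carryD _ (md_gt0 e) (r + n') n.
by rewrite /= h1 addrA IH -mulrDl h2.
Qed.

Lemma add0 e s : reduced e s -> add 0 s = s.
Proof.
elim: s e => //= -[r e'] s IH e /and3P[h1 h2 h3]. rewrite /=.
have [] := rep_carryE _ (md_gt0 e') r 0 h1; rewrite mul0r => -> ->.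
by rewrite mul0r (IH _ h3).
Qed.

(** If [s] starts with the sign opposite to [e], adding a multiple of its modulus keeps its first
    residue; if it starts with [e], that residue may vanish. So a carry never spoils reducedness. *)
Lemma reduced_add_mul e c s :
  reduced e s -> reduced e (add (c * (md (~~ e))%:Z) s).
Proof.
elim: s e c => //= -[r e'] s IH e c /and3P[h1 h2 h3].
rewrite /= rep_digit ?md_gt0 //= IH // andbT.
case: (eqVneq e' e) h2 => [-> _|ne h2]; first by rewrite implybT.
have -> : ~~ e = e' by case: (e) (e') ne => [] [].
by have [-> _] := rep_carryE _ (md_gt0 e') r c h1.
Qed.

Lemma reduced_add e n s : reduced e s -> exists e', reduced e' (add n s).
Proof.
case: s => [|[r e'] s] /=; first by exists true.
move=> /and3P[h1 h2 h3]; exists e'.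
by rewrite rep_digit ?md_gt0 // eqxx implybT reduced_add_mul.
Qed.

Lemma isdigit0 e : isdigit (md e) 0.
Proof. by rewrite /isdigit /off; have := md_gt0 e; lia. Qed.

Lemma reduced_push e e' s : reduced e' s -> exists e'', reduced e'' (push e s).
Proof.
case: s => [|[r e1] s] /=; first by exists e; rewrite isdigit0 eqxx.
move=> /and3P[h1 h2 h3]; case: ifP => h; first by exists e1.
exists e; rewrite /= isdigit0 eqxx h1 h3 /= andbT.
by move: h; case: (r == 0) => //=; case: (e) (e1) => [] [].
Qed.

Lemma push_reduced e s : reduced e s -> push e s = (0, e) :: s.
Proof.
case: s => [//|[r e1] s] /= /and3P[_ h _].
by case: eqP h => //= _ /eqP ->; case: (e).
Qed.

Lemma pushK e e' s : reduced e' s -> push (~~ e) (push e s) = s.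
Proof.
case: s => [|[r e1] s] /=; first by rewrite negbK eqxx.
move=> /and3P[h1 h2 h3]; case: ifP => h; last by rewrite /= negbK eqxx.
by case/andP: h => /eqP -> /eqP <-; rewrite push_reduced.
Qed.

Definition act_letter (x : letter) (s : stack) : stack :=
  if x.1 then push (~~ x.2) s else add (if x.2 then -1 else 1) s.

Definition act (w : word) (s : stack) : stack := foldr act_letter s w.

Lemma act_cat u v s : act (u ++ v) s = act u (act v s).
Proof. exact: foldr_cat. Qed.

Lemma reduced_act e w s : reduced e s -> exists e', reduced e' (act w s).
Proof.
move=> hs; elim: w => [|[b i] w [e' IH]] /=; first by exists e.
rewrite /act_letter /=; case: b.
  exact: reduced_push IH.
exact: reduced_add IH.
Qed.

Lemma act_nseq_la e n s : reduced e s -> act (nseq n la) s = add n%:Z s.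
Proof.
elim: n => [|n IH] hs /=; first by rewrite (add0 e).
by rewrite IH //= /act_letter /= add_add -addn1.
Qed.

Lemma act_nseq_laI e n s : reduced e s -> act (nseq n laI) s = add (- n%:Z) s.
Proof.
elim: n => [|n IH] hs /=; first by rewrite oppr0 (add0 e).
by rewrite IH //= /act_letter /= add_add -addn1; congr add; lia.
Qed.

Lemma rep_carry_md e : rep (md e) (md e)%:Z = 0 /\ carry (md e) (md e)%:Z = 1.
Proof.
have := rep_carryE _ (md_gt0 e) 0 1 (isdigit0 e).
by rewrite add0r mul1r.
Qed.

Lemma act_relator e s : reduced e s -> act (bs_relator p q) s = s.
Proof.
move=> hs; rewrite /bs_relator !act_cat (act_nseq_laI e) //.
have [e1 h1] : exists e', reduced e' (add (- q%:Z) s) by exact: reduced_add hs.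
(* With a^(-q) s as the new stack, the claim becomes t a^p t^-1 s = a^q s. *)
have -> : s = add q%:Z (add (- q%:Z) s) by rewrite add_add addNr (add0 e).
rewrite add_add subrr (add0 _ _ h1).
move: (add _ s) h1 => {hs e}s hs.
have [e2 h2] := reduced_push false _ _ hs.
rewrite /= {1}/act_letter /= {1}/act_letter /= (act_nseq_la _ _ _ h2).
have [rp cp] := rep_carry_md false.
case: s hs {h2 e2} => [|[r e2] s] /=; first by rewrite add0r rp.
(* Either t^-1 cancels a leading t, through which a^q is carried as a^p; or t^-1 is pushed, and a^p
   carried through it becomes a^q. *)
move=> /and3P[h1 h2 h3]; case: ifP => [/andP[/eqP -> /eqP e2t]|h].
  rewrite {}e2t {e2 h1 h2} in h3 *; have [] := rep_carry_md true; rewrite /= add0r => -> ->.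
  rewrite mul1r push_reduced //.
  by have := reduced_add_mul true 1 s h3; rewrite mul1r.
by rewrite /= add0r rp cp mul1r.
Qed.

(** The action descends to the group on reduced stacks, where [add0] and [pushK] make inverse
    letters cancel. *)
Lemma act_bs_eq u v e s : bs_eq p q u v -> reduced e s -> act u s = act v s.
Proof.
move=> uv; elim: uv e s => {u v} [//|u v _ IH|u v w _ IH1 _ IH2|u v [b i]|u v] e s hs.
- by rewrite (IH e).
- by rewrite (IH1 e) // (IH2 e).
- rewrite !act_cat /=; congr act.
  have [e1 h1] := reduced_act _ v _ hs.
  rewrite /act_letter /=; case: b => /=.
    by have := pushK i _ _ h1; rewrite negbK.
  by rewrite add_add; case: i => /=; rewrite ?addrN ?addNr (add0 _ _ h1).
- rewrite [LHS]act_cat [act (_ ++ v) s]act_cat [RHS]act_cat; congr act.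
  have [e1 h1] := reduced_act _ v _ hs.
  by rewrite (act_relator _ _ h1).
Qed.

Definition apow (r : int) : word := nseq `|r|%N (if r < 0 then laI else la).

Definition word_of (s : stack) : word :=
  flatten [seq rcons (apow x.1) (true, ~~ x.2) | x <- s].

(** From the base vertex [[::]], no power of t cancels and no digit carries, so the normal form is
    rebuilt. Hence the group element determines [s]. *)
Lemma act_word_of e s : reduced e s -> act (word_of s) [::] = s.
Proof.
elim: s e => [//|[r e'] s IH] e /= /and3P[h1 h2 h3].
rewrite /word_of /= act_cat -cats1 act_cat -/(word_of s) (IH _ h3) /=.
rewrite /act_letter /= negbK push_reduced //.
have h4 : reduced e' ((0, e') :: s) by rewrite /= isdigit0 eqxx.
have -> : act (apow r) ((0, e') :: s) = add r ((0, e') :: s).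
  rewrite /apow; case: ifP => r0.
    by rewrite (act_nseq_laI _ _ _ h4); congr add; lia.
  by rewrite (act_nseq_la _ _ _ h4); congr add; lia.
rewrite /= add0r.
have [] := rep_carryE _ (md_gt0 e') r 0 h1; rewrite mul0r addr0 => -> ->.
by rewrite mul0r (add0 _ _ h3).
Qed.

Lemma word_of_bs_inj e s s' : reduced e s -> reduced e s' ->
  bs_eq p q (word_of s) (word_of s') -> s = s'.
Proof.
move=> hs hs' h; have := act_bs_eq _ _ true [::] h isT.
by rewrite (act_word_of e) // (act_word_of e).
Qed.

End Action.

(** * Counting strings over a weighted alphabet *)

Section Strings.

Variables (B : eqType) (W : seq B) (wt : B -> nat) (M : nat).

Definition weight (c : seq B) : nat := (\sum_(b <- c) wt b)%N.

(** [k] bounds the number of symbols and makes the recursion structural; [n] bounds the weight. *)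
Fixpoint strings (k n : nat) : seq (seq B) :=
  [::] :: if k is k'.+1 then
    [seq b :: c | b <- [seq b <- W | wt b <= n]%N, c <- strings k' (n - wt b)]
  else [::].

Lemma strings_uniq k n : uniq W -> uniq (strings k n).
Proof.
move=> uW; elim: k n => [|k IH] n //=; apply/andP; split.
  by apply/negP => /allpairsPdep[b [c []]].
apply: allpairs_uniq_dep => [|b _|[b c] [b' c'] _ _ /= [-> ->] //].
  exact: filter_uniq.
exact: IH.
Qed.

Lemma stringsP k n c : c \in strings k n ->
  all (mem W) c /\ (weight c <= n)%N.
Proof.
rewrite /weight; elim: k n c => [|k IH] n c /=.
  by rewrite inE => /eqP ->; rewrite big_nil.
rewrite inE => /predU1P[->|]; first by rewrite big_nil.
move=> /allpairsPdep[b [c' [+ /IH[h1 h2] ->]]].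
by rewrite mem_filter big_cons /= => /andP[h3 ->]; split=> //; lia.
Qed.

(* By Kraft's equality, the number of strings of weight at most [n] and [x ^+ n] satisfy the same renewal inequality. *)
Lemma strings_size (R : realFieldType) (x : R) k n :
  (forall b, (0 < wt b)%N) -> {in W, forall b, (wt b <= M)%N} ->
  1 <= x -> \sum_(b <- W) x ^- wt b = 1 -> (n <= k)%N ->
  x ^+ n <= x ^+ M * (size (strings k n))%:R.
Proof.
move=> wt_gt0 wt_leM x1 kraft; have x0 : 0 < x by lra.
(* Up to weight [M] the empty string alone suffices, thanks to the factor [x ^+ M]. *)
have small k' n' : (n' <= M)%N -> x ^+ n' <= x ^+ M * (size (strings k' n'))%:R.
  move=> h; apply: (@le_trans _ _ (x ^+ M)); first exact: ler_weXn2l.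
  apply: ler_peMr; first by rewrite exprn_ge0 ?ltW.
  by rewrite ler1n; case: k'.
elim: k n => [|k IH] n nk; first by apply: small; lia.
case: (leqP n M) => [/small //|nM] /=.
have -> : [seq b <- W | wt b <= n]%N = W.
  by apply/all_filterP/allP => b /wt_leM /=; lia.
rewrite size_allpairs_dep sumnE big_map.
apply: (@le_trans _ _
    (x ^+ M * \sum_(b <- W) (size (strings k (n - wt b)))%:R)); last first.
  by rewrite ler_pM2l ?exprn_gt0 // -natr_sum ler_nat.
(* Kraft's sum, inserted as a factor 1, splits [x ^+ n] by first symbol. *)
rewrite -[x ^+ n]mulr1 -[X in _ * X <= _]kraft !mulr_sumr !big_seq.
apply: ler_sum => b bW; have h := wt_leM _ bW.
have <- : x ^+ (n - wt b) = x ^+ n * x ^- wt b.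
  by apply: expfB_cond; rewrite gt_eqF //=; lia.
by apply: IH; have := wt_gt0 b; lia.
Qed.

End Strings.

(** * Nonzero balanced residues and their generating sum *)

Definition digits (m : nat) : seq int :=
  [seq i%:Z | i <- iota 1 m./2] ++ [seq - i%:Z | i <- iota 1 m.-1./2].

Lemma digits_uniq m : uniq (digits m).
Proof.
rewrite cat_uniq !map_inj_uniq ?iota_uniq /=; first last.
- by move=> i j; lia.
- by move=> i j; lia.
rewrite andbT -all_predC; apply/allP => _ /mapP[i + ->] /=; rewrite mem_iota => hi.
by apply/mapP => -[j]; rewrite mem_iota; lia.
Qed.

Lemma digitsP m r : r \in digits m -> [&& isdigit m r, r != 0 & `|r| <= m./2]%N.
Proof.
by rewrite mem_cat => /orP[] /mapP[i]; rewrite mem_iota /isdigit /off; lia.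
Qed.

(** Each positive absolute value below [m./2] occurs with both signs; [m./2] itself occurs [Cpar m]
    times. *)
Lemma sum_digits (R : fieldType) (x : R) m l :
  (2 <= m)%N -> (m./2 <= l)%N -> x != 0 ->
  x ^+ l * \sum_(r <- digits m) x ^- `|r|%N =
  2 * (\sum_(1 <= i < m./2) x ^+ (l - i)) + (Cpar m)%:R * x ^+ (l - m./2).
Proof.
move=> m2 ml x0; rewrite big_cat !big_map /= mulrDr !mulr_sumr.
have eqh h : (h <= m./2)%N -> \sum_(i <- iota 1 h) x ^+ l * x ^- `|i%:Z|%N =
    \sum_(1 <= i < h.+1) x ^+ (l - i).
  have -> : iota 1 h = index_iota 1 h.+1 by rewrite /index_iota subn1.
  move=> hh; rewrite big_seq [RHS]big_seq.
  apply: eq_bigr => i; rewrite mem_index_iota => hi.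
  by rewrite -expfB_cond ?(negPf x0) //=; lia.
under [X in _ + X]eq_bigr => i _ do rewrite abszN.
rewrite -[X in _ = X + _]mulr_sumr !eqh; try lia.
rewrite big_nat_recr /=; last lia.
rewrite /Cpar; case: ifP => om.
  have -> : m.-1./2 = m./2 by lia.
  rewrite big_nat_recr /=; last lia.
  by ring.
have -> : m.-1./2.+1 = m./2 by lia.
by ring.
Qed.

(** * Normal forms as strings, and Kraft's equality *)

Section NormalForms.

Variables p q : nat.
Hypothesis p_ge2 : (2 <= p)%N.
Hypothesis p_le_q : (p <= q)%N.

(* Britton-reduced normal forms become arbitrary strings of syllables: [Some (r, e)] stands for a^r t^e with r nonzero, and [None] for a repetition of the previous power of t. *)
Definition syllable := option (int * bool).

Definition syllables : seq syllable :=
  None :: [seq Some (r, true) | r <- digits q]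
       ++ [seq Some (r, false) | r <- digits p].

Definition syllable_length (b : syllable) : nat := if b is Some x then `|x.1|.+1%N else 1.

(** [e] is the sign that [None] repeats; the initial one is a convention, later fixed to [true]. *)
Fixpoint stack_of (e : bool) (c : seq syllable) : stack :=
  if c is b :: c' then
    if b is Some (r, e') then (r, e') :: stack_of e' c' else (0, e) :: stack_of e c'
  else [::].

Lemma syllables_uniq : uniq syllables.
Proof.
rewrite /syllables /= cat_uniq !map_inj_uniq ?digits_uniq /=;
  try by move=> ? ? [].
rewrite andbT mem_cat negb_or -andbA; apply/and3P; split.
- by apply/mapP => -[].
- by apply/mapP => -[].
- by apply/hasPn => _ /mapP[r _ ->]; apply/mapP => -[].
Qed.

Lemma syllablesP r e : Some (r, e) \in syllables ->
  [&& isdigit (md p q e) r, r != 0 & `|r| <= q./2]%N.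
Proof.
rewrite inE /= mem_cat => /orP[] /mapP[r' /digitsP h [-> ->]] //=.
by move: h => /and3P[-> -> /= h]; apply: leq_trans h (half_leq p_le_q).
Qed.

Lemma syllable_length_le : {in syllables, forall b, (syllable_length b <= q./2.+1)%N}.
Proof. by move=> [[r e] /syllablesP/and3P[]|]. Qed.

Lemma reduced_stack_of e c : all (mem syllables) c -> reduced p q e (stack_of e c).
Proof.
elim: c e => //= -[[r e']|] c IH e /andP[h1 h2].
  by move/syllablesP: h1 => /and3P[h1 h3 _]; rewrite /= h1 (negPf h3) IH.
by rewrite /= isdigit0 ?eqxx ?IH //; lia.
Qed.

(** Among syllables only [None] yields a residue 0, and the sign it stands for is known from what
    precedes. *)
Lemma stack_of_inj e c c' : all (mem syllables) c -> all (mem syllables) c' ->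
  stack_of e c = stack_of e c' -> c = c'.
Proof.
elim: c c' e => [|b c IH] [|b' c'] e //.
- by case: b' => [[r e']|] _ _.
- by case: b => [[r e']|] _ _.
rewrite /= => /andP[hb hc] /andP[hb' hc'].
case: b hb => [[r e1]|] hb; case: b' hb' => [[r' e2]|] hb' //.
- by case=> -> -> /IH ->.
- by case=> r0; move/syllablesP: hb; rewrite r0 eqxx andbF.
- by case=> r0; move/syllablesP: hb'; rewrite -r0 eqxx andbF.
- by case=> /IH ->.
Qed.

Lemma size_word_of_cons r e s :
  size (word_of ((r, e) :: s)) = (`|r|.+1 + size (word_of s))%N.
Proof. by rewrite [LHS]size_cat size_rcons size_nseq. Qed.

Lemma size_word_of_stack_of e c : size (word_of (stack_of e c)) = weight _ syllable_length c.
Proof.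
rewrite /weight; elim: c e => [|b c IH] e; first by rewrite big_nil.
by rewrite big_cons; case: b => [[r e']|]; rewrite [stack_of _ _]/= size_word_of_cons IH.
Qed.

Lemma stack_of_bs_inj c c' :
  all (mem syllables) c -> all (mem syllables) c' ->
  bs_eq p q (word_of (stack_of true c)) (word_of (stack_of true c')) -> c = c'.
Proof.
move=> hc hc' h; apply: (stack_of_inj true) => //.
by apply: (word_of_bs_inj _ _ _ _ true _ _ _ _ h); rewrite ?reduced_stack_of //; lia.
Qed.

(** Multiplied by x^(l+1), with l = [q./2], the sum gets x^l from [None] and the lower terms of
    [P_pq] from the two families of digits. *)
Lemma kraft_syllables (R : realType) (x : R) :
  0 < x -> P_pq p q x = 0 -> \sum_(b <- syllables) x ^- syllable_length b = 1.
Proof.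
move=> x0 P0; have xn0 : x != 0 by rewrite gt_eqF.
rewrite big_cons big_cat !big_map /=.
under eq_bigr => r _ do rewrite exprS invfM.
under [X in _ + (_ + X)]eq_bigr => r _ do rewrite exprS invfM.
rewrite -!mulr_sumr -mulrDr expr1.
have xl : x ^+ q./2.+1 != 0 by rewrite expf_neq0.
have shift y : x ^+ q./2.+1 * (x^-1 * y) = x ^+ q./2 * y.
  by rewrite exprSr -mulrA mulVKf.
apply: (mulfI xl); rewrite mulr1 -[X in _ * (X + _)]mulr1 -mulrDr shift !mulrDr.
rewrite mulr1 !sum_digits //; try lia.
rewrite subnn expr0 mulr1.
have -> : \sum_(1 <= i < q./2) x ^+ (q./2 - i) = \sum_(1 <= i < q./2) x ^+ i.
  rewrite big_nat_rev /= big_nat [RHS]big_nat; apply: eq_bigr => i hi.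
  by congr (_ ^+ _); lia.
apply/esym/subr0_eq; rewrite -[RHS]P0 /P_pq.
case: ifP => p4; first by ring.
(* For p = 2 and p = 3 the sum over k is empty, and each special polynomial is an instance of the
   general formula. *)
have p1 : p./2 = 1%N by lia.
rewrite p1 (big_geq (leqnn 1)) subn1 mulr0 add0r.
case: eqP => p2.
  rewrite p2 /=; case: eqP => q2.
    by rewrite q2 /= big_geq //= /Cpar /=; ring.
  case: eqP => q3; first by rewrite q3 /= big_geq //= /Cpar /=; ring.
  by rewrite /Cpar /=; ring.
have -> : p = 3%N by lia.
case: eqP => q3; first by rewrite q3 /= big_geq //= /Cpar /=; ring.
by rewrite /Cpar /=; ring.
Qed.

End NormalForms.

(** * Balls of words and choice of representatives *)

Lemma mem_words_len k (w : word) : (w \in words_len k) = (size w == k).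
Proof.
elim: k w => [|k IH] [|x w] //; rewrite /words_len -/words_len.
  by apply/negP => /allpairsP[[? ?] []].
rewrite eqSS -IH; apply/allpairsP/idP => [[[y w'] /= [_ h [_ ->]]] //|h].
by exists (x, w); split=> //=; case: x => [] [] [].
Qed.

Lemma mem_ball_words n (w : word) : (w \in ball_words n) = (size w <= n)%N.
Proof.
apply/flatten_mapP/idP => [[k]|h].
  by rewrite mem_iota mem_words_len => h /eqP ->; lia.
by exists (size w); rewrite ?mem_words_len // mem_iota; lia.
Qed.

(* Counting the entries of a list not equivalent to an earlier entry amounts to choosing a transversal. *)
Lemma transversal_first (T : Type) (x0 : T) (E : T -> T -> Prop) (L : seq T) :
  (forall x, E x x) -> (forall x y, E x y -> E y x) ->
  (forall x y z, E x y -> E y z -> E x z) ->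
  exists I : seq nat,
    [/\ size I = (\sum_(i < size L)
          ~~ `[< exists j : nat, (j < i)%N /\ E (nth x0 L j) (nth x0 L i) >])%N,
        uniq I, {in I, forall i, (i < size L)%N},
        {in I &, forall i j, E (nth x0 L i) (nth x0 L j) -> i = j} &
        forall k, (k < size L)%N ->
          exists2 i, i \in I & E (nth x0 L k) (nth x0 L i)].
Proof.
move=> Er Es Et.
pose first i := ~~ `[< exists j : nat, (j < i)%N /\ E (nth x0 L j) (nth x0 L i) >].
exists [seq i <- iota 0 (size L) | first i]; split.
- rewrite size_filter -sum1_count -{1}[size L]subn0 -/(index_iota 0 (size L)).
  by rewrite big_mkcond big_mkord; apply: eq_bigr => i _; rewrite /first; case: ifP.
- exact/filter_uniq/iota_uniq.
- by move=> i; rewrite mem_filter mem_iota => /andP[_]; lia.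
- move=> i j; rewrite !mem_filter => /andP[/asboolPn fi _] /andP[/asboolPn fj _] ij.
  case: (ltngtP i j) => // h.
    by case: fj; exists i.
  by case: fi; exists j; split=> //; apply: Es.
- move=> k; elim/ltn_ind: k => k IH kL; case: (boolP (first k)) => fk.
    by exists k => //; rewrite mem_filter fk mem_iota.
  move: fk; rewrite negbK => /asboolP[j [jk Ejk]].
  have [i iI Eji] := IH j jk (ltn_trans jk kL).
  by exists i => //; apply: Et Eji; apply: Es.
Qed.

(** * Estimates of the growth function *)

Section Gamma.

Variables p q : nat.

Definition inequiv (ws : seq word) : Prop :=
  uniq ws /\ {in ws &, forall u v, bs_eq p q u v -> u = v}.

(** Choosing an equivalent word in [rs] for each word of [ws] is injective, since two words with the
    same choice are equivalent. *)
Lemma size_inequiv (ws rs : seq word) : inequiv ws ->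
  {in ws, forall w, exists2 r, r \in rs & bs_eq p q w r} ->
  (size ws <= size rs)%N.
Proof.
move=> [uws iws] cov.
have /choice[f fP] : forall w, exists r, w \in ws -> r \in rs /\ bs_eq p q w r.
  move=> w; case: (boolP (w \in ws)) => [/cov[r h1 h2]|_]; last by exists [::].
  by exists r.
rewrite -(size_map f); apply: uniq_leq_size.
  rewrite map_inj_in_uniq // => u v hu hv fuv.
  apply: iws => //; have [_ h1] := fP _ hu; have [_ h2] := fP _ hv.
  by apply: bs_trans h1 _; rewrite fuv; apply: bs_sym.
by move=> _ /mapP[w /fP[h _] ->].
Qed.

(** Trades the sum in [bs_gamma] for a list of representatives of the ball, on which the estimates
    below rest. *)
Lemma bs_gamma_transversal n : exists rs : seq word,
  [/\ size rs = bs_gamma p q n, inequiv rs,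
      {in rs, forall r, (size r <= n)%N} &
      forall w, (size w <= n)%N -> exists2 r, r \in rs & bs_eq p q w r].
Proof.
have [I [sI uI IL iI cI]] := transversal_first _ [::] (bs_eq p q)
  (ball_words n) (bs_refl p q) (@bs_sym p q) (@bs_trans p q).
exists [seq nth [::] (ball_words n) i | i <- I]; split.
- by rewrite size_map sI.
- split=> [|_ _ /mapP[i hi ->] /mapP[j hj ->] h]; last by rewrite (iI i j).
  rewrite map_inj_in_uniq // => i j hi hj h; apply: iI => //.
  by rewrite h; apply: bs_refl.
- by move=> _ /mapP[i /IL h ->]; rewrite -mem_ball_words mem_nth.
- move=> w; rewrite -mem_ball_words => hw.
  have := cI (index w (ball_words n)); rewrite index_mem nth_index //.
  by move=> /(_ hw)[i hi h]; exists (nth [::] (ball_words n) i) => //; apply: map_f.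
Qed.

Lemma leq_bs_gamma n (ws : seq word) : inequiv ws ->
  {in ws, forall w, (size w <= n)%N} -> (size ws <= bs_gamma p q n)%N.
Proof.
have [rs [<- _ _ cov]] := bs_gamma_transversal n.
by move=> h1 h2; apply: size_inequiv h1 _ => w /h2 /cov.
Qed.

Lemma bs_gamma_gt0 n : (0 < bs_gamma p q n)%N.
Proof.
apply: (leq_bs_gamma n [:: [::]]); last by move=> w; rewrite inE => /eqP ->.
by split=> // u v; rewrite !inE => /eqP -> /eqP ->.
Qed.

(** Cut a word of length at most [m + n] after [m] letters and represent both pieces. *)
Lemma bs_gammaD m n : (bs_gamma p q (m + n) <= bs_gamma p q m * bs_gamma p q n)%N.
Proof.
have [rs [<- _ _ crs]] := bs_gamma_transversal m.
have [rs' [<- _ _ crs']] := bs_gamma_transversal n.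
have [ws [<- iws sws _]] := bs_gamma_transversal (m + n).
rewrite -(size_allpairs cat rs rs'); apply: size_inequiv => // w /sws sw.
have [|r hr er] := crs (take m w); first by rewrite size_take; case: ltnP.
have [|r' hr' er'] := crs' (drop m w); first by rewrite size_drop leq_subLR.
exists (r ++ r'); first by apply/allpairsP; exists (r, r').
by rewrite -{1}(cat_take_drop m w); apply: bs_eq_cat.
Qed.

(** Strings of weight at most [n] give pairwise inequivalent words of length at most [n]; [q./2.+1]
    bounds every syllable length. *)
Lemma exp_le_bs_gamma (R : realType) (x : R) n : (2 <= p)%N -> (p <= q)%N ->
  1 <= x -> P_pq p q x = 0 -> x ^+ n <= x ^+ q./2.+1 * (bs_gamma p q n)%:R.
Proof.
move=> hp hpq x1 P0; have x0 : 0 < x by lra.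
have su := syllables_uniq p q.
have kraft : \sum_(b <- syllables p q) x ^- syllable_length b = 1 by exact: kraft_syllables.
have wt_gt0 b : (0 < syllable_length b)%N by case: b.
have := strings_size _ _ _ _ R x n n wt_gt0 (syllable_length_le p q hpq) x1 kraft (leqnn n).
move=> /le_trans; apply.
rewrite ler_pM2l ?exprn_gt0 // ler_nat.
set cs := strings _ _ _ _ _.
rewrite -(size_map (word_of \o stack_of true)).
have csP c : c \in cs -> all (mem (syllables p q)) c /\ (weight _ syllable_length c <= n)%N.
  exact: stringsP.
have inj : {in cs &, forall c c', bs_eq p q (word_of (stack_of true c))
    (word_of (stack_of true c')) -> c = c'}.
  by move=> c c' /csP[hc _] /csP[hc' _]; apply: stack_of_bs_inj.
apply: leq_bs_gamma => [|_ /mapP[c /csP[_ h] ->]]; last first.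
  by rewrite /= size_word_of_stack_of.
split=> [|_ _ /mapP[c hc ->] /mapP[c' hc' ->] h]; last by rewrite (inj c c').
rewrite map_inj_in_uniq; first exact: strings_uniq.
by move=> c c' hc hc' h; apply: inj => //; rewrite -[word_of (stack_of true c')]h; apply: bs_refl.
Qed.

End Gamma.

(** * Fekete's lemma *)

Lemma fekete_cvg (R : realType) (a : nat -> R) :
  (forall n, 0 <= a n) -> (forall m n, a (m + n)%N <= a m + a n) ->
  exists L : R, a n / n%:R @[n --> \oo] --> L.
Proof.
move=> a0 aD.
(* [a 0] may be positive, so [d = 0] is excluded; hence the case splits below. *)
have aM d n : (0 < d)%N -> a (d * n)%N <= d%:R * a n.
  elim: d => // -[|d] IH _; first by rewrite mul1n mul1r.
  rewrite mulSn; apply: le_trans (aD _ _) _.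
  by rewrite -[d.+2]addn1 natrD mulrDl mul1r addrC lerD2r IH.
pose A := [set a n.+1 / n.+1%:R | n in [set: nat]].
have Alb : has_lbound A by exists 0 => _ [n _ <-]; rewrite divr_ge0.
have Ainf : has_inf A by split=> //; exists (a 1%N / 1%:R), 0%N.
exists (inf A); apply/cvgrPdist_le => e e0.
have e20 : 0 < e / 2 by rewrite divr_gt0.
have [_ [n _ <-] hn] := inf_adherent e20 Ainf.
(* Divide N by a fixed [n.+1] nearly attaining the infimum. The constant bounds [a] on all
   remainders: [a 0] for remainder 0, multiples of [a 1] for the others. *)
have aub N : a N <= N%:R * (a n.+1 / n.+1%:R) + (a 0%N + n.+1%:R * a 1%N).
  have ap0 : a N <= (N %/ n.+1)%:R * a n.+1 + a (N %% n.+1)%N.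
    case: (posnP (N %/ n.+1)) => [d0|d0].
      by rewrite d0 mul0r add0r {1}(divn_eq N n.+1) d0.
    rewrite {1}(divn_eq N n.+1); apply: le_trans (aD _ _) _.
    by rewrite lerD2r aM.
  apply: le_trans ap0 (lerD _ _).
    rewrite [leRHS]mulrCA [leLHS]mulrC; apply: ler_wpM2l => //.
    by rewrite ler_pdivlMr // -natrM ler_nat leq_divM.
  case: (posnP (N %% n.+1)) => [->|s0].
    by rewrite lerDl mulr_ge0.
  have := aM _ 1%N s0; rewrite muln1 => /le_trans; apply.
  rewrite ler_wpDl // ler_wpM2r // ler_nat.
  by rewrite ltnW // ltn_pmod.
set K := a 0%N + _ in aub.
have K0 : 0 <= K by rewrite addr_ge0 ?mulr_ge0.
near=> N.
have N0 : (0 < N)%N by near: N; exact: nbhs_infty_gt.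
have NR : 0 < N%:R :> R by rewrite ltr0n.
have h1 : inf A <= a N / N%:R.
  by apply: ge_inf => //; exists N.-1 => //; rewrite prednK.
have h2 : a N / N%:R <= a n.+1 / n.+1%:R + K / N%:R.
  by rewrite ler_pdivrMr // mulrDl divfK ?gt_eqF // mulrC.
have h3 : K / N%:R <= e / 2.
  rewrite ler_pdivrMr // -ler_pdivrMl ?divr_gt0 //.
  near: N; exact: nbhs_infty_ger.
rewrite ler0_norm ?subr_le0 // opprB lerBlDl; apply: le_trans h2 _.
rewrite [e in leRHS]splitr addrA; exact: lerD (ltW hn) h3.
Unshelve. all: by end_near.
Qed.

(** * The growth rate and its comparison with the roots *)

Theorem theorem5p3 (R : realType) (p q : nat) (hp : (2 <= p)%N) (hpq : (p <= q)%N) :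
  exists lam : R,
    bs_growth_seq R p q @ \oo --> lam /\
    (forall x : R, P_pq p q x = 0 -> x <= lam).
Proof.
pose a n : R := ln (bs_gamma p q n)%:R.
have g0 n : 0 < (bs_gamma p q n)%:R :> R by rewrite ltr0n bs_gamma_gt0.
have a0 n : 0 <= a n by rewrite ln_ge0 // ler1n bs_gamma_gt0.
have [m n|L aL] := fekete_cvg R a a0.
  by rewrite /a -lnM ?posrE // ler_ln ?posrE ?mulr_gt0 // -natrM ler_nat bs_gammaD.
have L0 : 0 <= L.
  by apply: (cvgr_to_ge aL); apply: nearW => n; rewrite divr_ge0.
exists (expR L); split.
  have -> : bs_growth_seq R p q = expR \o (fun n => a n / n%:R).
    by apply/funext => n; rewrite /bs_growth_seq /powR gt_eqF //= mulrC.
  by apply: continuous_cvg aL; apply: continuous_expR.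
(* Roots up to 1 need no counting: [0 <= L] makes the limit at least 1. *)
move=> x P0; case: (leP x 1) => x1.
  by apply: le_trans x1 _; rewrite -expR0 ler_expR.
have x0 : 0 < x by lra.
rewrite -[x]lnK ?posrE // ler_expR.
set M := q./2.+1.
(* Logarithm of x^n <= x^M gamma(n), divided by n; the correction M ln x / n tends to 0. *)
have bnd n : (0 < n)%N -> ln x - M%:R * ln x / n%:R <= a n / n%:R.
  move=> n0; have nR : 0 < n%:R :> R by rewrite ltr0n.
  rewrite ler_pdivlMr // mulrBl divfK ?gt_eqF // lerBlDl.
  have := exp_le_bs_gamma p q R x n hp hpq (ltW x1) P0.
  rewrite /a -/M; move: (bs_gamma p q n)%:R (g0 n) => g gpos.
  rewrite -ler_ln ?posrE ?mulr_gt0 ?exprn_gt0 // lnM ?posrE ?exprn_gt0 //.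
  by rewrite !lnXn // mulr_natr mulr_natl.
apply: (ler_cvg_to _ aL); last by near=> n; apply: bnd; near: n; exact: nbhs_infty_gt.
rewrite -[X in _ --> X]subr0; apply: cvgB; first exact: cvg_cst.
rewrite -[X in _ --> X](mulr0 (M%:R * ln x)); apply: cvgMl_tmp.
apply/gtr0_cvgV0; last exact: cvgr_idn.
by near=> n; rewrite ltr0n; near: n; exact: nbhs_infty_gt.
Unshelve. all: by end_near.
Qed.
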